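(* Let $\mathcal H$ be a real Hilbert space, let $f\in\Gamma_0(\mathcal H)$, let $\beta\in\left]0,+\infty\right[$, let $q=\frac12\|\cdot\|^2$, and set $h=f^*-q/\beta$. Then the following are equivalent. (i) $f$ is Fréchet differentiable on $\mathcal H$ and $\nabla f$ is $\beta$-Lipschitz continuous. (ii) $\beta q-f$ is convex. (iii) $f^*-q/\beta$ is convex (i.e., $f^*$ is $1/\beta$-strongly convex). (iv) $h\in\Gamma_0(\mathcal H)$ and $f=\mathrm{env}_{1/\beta}(h^* )=\beta q-\mathrm{env}_{\beta}(h)\circ(\beta\,\mathrm{Id})$. (v) $h\in\Gamma_0(\mathcal H)$ and $\nabla f=\mathrm{Prox}_{\beta h}\circ(\beta\,\mathrm{Id})=\beta(\mathrm{Id}-\mathrm{Prox}_{h^*/\beta})$. (vi) $f$ is Fréchet differentiable on $\mathcal H$ and $\nabla f$ is $1/\beta$-cocoercive.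
   Context: $\mathcal H$ is a real Hilbert space with scalar product $\langle\cdot\mid\cdot\rangle$ and induced norm $\|\cdot\|$; $\mathrm{Id}$ is the identity operator on $\mathcal H$. $\Gamma_0(\mathcal H)$ is the class of proper lower semicontinuous convex functions from $\mathcal H$ to $\left]-\infty,+\infty\right]$. The conjugate of $f\colon\mathcal H\to\left]-\infty,+\infty\right]$ is $f^*\colon u\mapsto\sup_{x\in\mathcal H}(\langle x\mid u\rangle-f(x))$. The function $q$ is $q(x)=\frac12\|x\|^2$. The infimal convolution of two functions is $(\varphi\,\square\,\psi)(x)=\inf_{y\in\mathcal H}(\varphi(y)+\psi(x-y))$. For $\varphi\in\Gamma_0(\mathcal H)$ and $\gamma\in\left]0,+\infty\right[$, the Moreau envelope of $\varphi$ of index $\gamma$ is $\mathrm{env}_{\gamma}(\varphi)=\varphi\,\square\,(q/\gamma)$, and the proximity operator of $\varphi$ is $\mathrm{Prox}_\varphi=(\mathrm{Id}+\partial\varphi)^{-1}$, where $\partial\varphi$ is the subdifferential; it maps each $x\in\mathcal H$ to the unique minimizer of $y\mapsto\varphi(y)+q(x-y)$. In (ii), the function $\beta q-f$ takes the value $-\infty$ at points where $f=+\infty$, and convexity of an extended-real-valued function means convexity of its epigraph. An operator $T\colon\mathcal H\to\mathcal H$ is $1/\beta$-cocoercive if $\beta\langle x-y\mid Tx-Ty\rangle\ge\|Tx-Ty\|^2$ for all $x,y\in\mathcal H$, and $\beta$-Lipschitz continuous if $\|Tx-Ty\|\le\beta\|x-y\|$ for all $x,y\in\mathcal H$. *)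

(* Defs.v *)
From HB Require Import structures.
From mathcomp Require Import all_boot all_order all_algebra.
From mathcomp Require Import all_classical all_reals all_analysis.
Import Order.TTheory GRing.Theory Num.Theory.
Import numFieldNormedType.Exports.

Set Implicit Arguments.
Unset Strict Implicit.
Unset Printing Implicit Defensive.

Local Open Scope classical_set_scope.
Local Open Scope ring_scope.
Local Open Scope ereal_scope.

(* A real Hilbert space is a complete normed space H together with a dot
   product inducing its norm; the latter is a hypothesis on dot, stated where
   the space is introduced. *)
Definition induces_norm (R : realType) (H : completeNormedModType R)
    (dot : H -> H -> R) : Prop :=
  forall x : H, (`|x| ^+ 2 = dot x x)%R.

Section ConvexAnalysis.
Context {R : realType} {H : completeNormedModType R}.
Variable dot : H -> H -> R.
Implicit Types (phi psi f : H -> \bar R) (T : H -> H) (x y u v p g : H).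

Definition q x : R := (2^-1 * `|x| ^+ 2)%R.

Definition epigraph phi : set (H * R^o) := [set z | phi z.1 <= z.2%:E].

(* phi may take the value -oo, so convexity is stated on the epigraph. *)
Definition econvex phi : Prop := @convex_set R (H * R^o)%type (epigraph phi).

Definition proper phi : Prop :=
  (forall x, phi x != -oo) /\ (exists x, phi x < +oo).

Definition Gamma0 phi : Prop :=
  [/\ proper phi, lower_semicontinuous phi & econvex phi].

Definition conjugate phi : H -> \bar R :=
  fun u => ereal_sup (range (fun x => (dot x u)%:E - phi x)).

Definition infconv phi psi : H -> \bar R :=
  fun x => ereal_inf (range (fun y => phi y + psi (x - y)%R)).

Definition env (gamma : R) phi : H -> \bar R :=
  infconv phi (fun x => (q x / gamma)%:E).

Definition subdifferential phi x : set H :=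
  [set u | forall y, (dot (y - x)%R u)%:E + phi x <= phi y].

(* The resolvent of the subdifferential: p = Prox phi x iff x belongs to
   p + subdifferential phi p. For phi in Gamma0 such a p exists and is unique,
   so the default value 0 is irrelevant. *)
Definition Prox phi : H -> H :=
  fun x => xget 0%R [set p | subdifferential phi p (x - p)%R].

(* Differentiability at every point of H forces f to be real-valued. *)
Definition frechet_differentiable f : Prop :=
  (forall x, f x \is a fin_num) /\
  (forall x, differentiable (fine \o f : H -> R^o) x).

(* The Riesz representative of the Frechet derivative; it exists and is unique
   wherever f is differentiable, so the default value 0 is irrelevant there. *)
Definition gradient f : H -> H :=
  fun x => xget 0%R
    [set g | forall v, 'd (fine \o f : H -> R^o) x v = dot v g].

(* T is (1 / beta)-cocoercive. *)
Definition inv_cocoercive (beta : R) T : Prop :=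
  forall x y,
    (`|T x - T y| ^+ 2 <= beta * dot (x - y) (T x - T y))%R.

End ConvexAnalysis.

(* Main.v *)
(* The proximal point of a function in Gamma_0 exists by completeness, and it
   provides subgradients; these yield the affine minorants behind the
   Fenchel-Moreau theorem as well as Riesz representatives of differentials.
   (i) => (ii): the descent lemma says that beta q - f lies above its tangents.
   (ii) => (iii): such an f is finite, and every affine minorant
   <. | v> + d of g = beta q - f gives the affine minorant
   <. | v> / beta + q v / beta + d of h = f^* - q / beta, whose supremum over
   (v, d) is h.
   (iii) => (iv), (v), (vi): for each x, the proximal point p of beta h at
   beta x maximizes <x | u> - f^* u. Evaluating at p gives both envelope
   formulas, and the optimality condition x - p / beta \in subdifferential h p
   gives both proximity formulas and the cocoercivity of x |-> p, whose
   Lipschitz continuity squeezes f to be differentiable with gradient p. *)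
Require Import Defs.
From HB Require Import structures.
From mathcomp Require Import all_boot all_order all_algebra.
From mathcomp Require Import all_classical all_reals all_analysis.
From mathcomp Require Import ring lra.
Import Order.TTheory GRing.Theory Num.Theory.
Import numFieldNormedType.Exports.

Set Implicit Arguments.
Unset Strict Implicit.
Unset Printing Implicit Defensive.

Local Open Scope classical_set_scope.
Local Open Scope ring_scope.
Local Open Scope ereal_scope.

(** * Inner products *)

Section InnerProduct.
Context {R : realType} {H : completeNormedModType R}.
Variables (dot : {dot H for idfun}) (hdot : induces_norm dot).
Implicit Types (x y z : H) (a : R).
Local Open Scope ring_scope.

Lemma dotC x y : dot x y = dot y x.
Proof. by rewrite hermC /= expr0 mul1r. Qed.

Lemma dotDl x y z : dot (x + y) z = dot x z + dot y z.
Proof. by rewrite linearDl. Qed.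

Lemma dotDr x y z : dot z (x + y) = dot z x + dot z y.
Proof. by rewrite dotC dotDl !(dotC z). Qed.

Lemma dotNl x z : dot (- x) z = - dot x z.
Proof. by rewrite linearNl. Qed.

Lemma dotNr x z : dot z (- x) = - dot z x.
Proof. by rewrite dotC dotNl (dotC z). Qed.

Lemma dotZl a x z : dot (a *: x) z = a * dot x z.
Proof. by rewrite linearZl_LR. Qed.

Lemma dotZr a x z : dot z (a *: x) = a * dot z x.
Proof. by rewrite dotC dotZl (dotC z). Qed.

Definition dotE := (dotDl, dotDr, dotNl, dotNr, dotZl, dotZr).

Lemma dot_ge0 x : 0 <= dot x x.
Proof. by rewrite -hdot sqr_ge0. Qed.

Lemma qE x : q x = 2^-1 * dot x x.
Proof. by rewrite /q hdot. Qed.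

Lemma dot0l x : dot 0 x = 0.
Proof. by rewrite linear0l. Qed.

(** Cauchy-Schwarz: expand the square of [|y| *: x - |x| *: y], whose norm weights turn it into a
    multiple of [|x| |y| - dot x y]. *)
Lemma dot_le_norm x y : dot x y <= `|x| * `|y|.
Proof.
have [->|x0] := eqVneq x 0; first by rewrite dot0l normr0 mul0r.
have [->|y0] := eqVneq y 0; first by rewrite dotC dot0l normr0 mulr0.
have xy : 0 < `|x| * `|y| by rewrite mulr_gt0 ?normr_gt0.
have := dot_ge0 (`|y| *: x - `|x| *: y).
rewrite !dotE -!hdot (dotC y x) => H0.
have : 0 <= (`|x| * `|y| - dot x y) * (`|x| * `|y|) by nra.
by rewrite pmulr_lge0// subr_ge0.
Qed.

End InnerProduct.


(** * Convex functions and proximal points *)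

Section ConvexFunctions.
Context {R : realType} {H : completeNormedModType R}.
Implicit Types (phi : H -> \bar R) (x y p u : H) (a b c r t M : R).
Local Open Scope ring_scope.

(** Real upper bounds replace the values of [phi], so that no [+oo - oo] arises when [phi] takes
    both infinite values. *)
Lemma econvexP phi : econvex phi <->
  (forall x y a b t, 0 <= t <= 1 ->
    (phi x <= a%:E)%E -> (phi y <= b%:E)%E ->
    (phi (t *: x + (1 - t) *: y)%R <= (t * a + (1 - t) * b)%:E)%E).
Proof.
split=> [cphi x y a b t /andP[t0 t1] xa yb|cphi [x a] [y b] t].
  have tP : (0 <= t <= 1)%R by rewrite t0.
  have := @cphi (x, a) (y, b) (Itv01 t0 t1).
  rewrite /epigraph !inE /= => /(_ xa yb).
  by rewrite /conv.
rewrite !inE /epigraph /= => xa yb.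
have := cphi x y a b t%:num _ xa yb; apply.
by rewrite ge0 le1.
Qed.

Lemma EFin_le (a : R) (s : \bar R) :
  (forall b : R, (s <= b%:E)%E -> a <= b) -> (a%:E <= s)%E.
Proof.
case: s => [s||] sa; last 1 first.
- by have := sa (a - 1) (leNye _); rewrite lerBrDr gerDl ler10.
- by rewrite lee_fin sa.
- by rewrite leey.
Qed.

(* Lower semicontinuity bounds [phi] from below near a point [x0] of its domain;
   convexity on the segments issued from [x0] propagates this bound. *)
Lemma Gamma0_minorized phi : Gamma0 phi ->
  exists x0 a b, 0 <= b /\ forall y, ((a - b * `|y - x0|)%:E <= phi y)%E.
Proof.
move=> [[phiNy [x0 x0y]] lphi /econvexP cphi].
have [r0 phix0] : exists r0, phi x0 = r0%:E.
  by exists (fine (phi x0)); rewrite fineK// fin_numE phiNy lt_eqF.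
have [|V /nbhs_ballP[e /= e0 eV] Vphi] := lphi x0 (r0 - 1).
  by rewrite phix0 lte_fin; lra.
exists x0, (r0 - 1), (2 / e); split=> [|y].
  by rewrite divr_ge0// ltW.
apply: EFin_le => c yc.
have [ye|ye] := leP `|y - x0| (e / 2).
  have : ((r0 - 1)%:E < c%:E)%E.
    apply: lt_le_trans yc; apply/Vphi/eV.
    by rewrite -ball_normE /= distrC; apply: le_lt_trans ye _; lra.
  rewrite lte_fin => r0c.
  have : 0 <= 2 / e * `|y - x0| by rewrite mulr_ge0// divr_ge0 ?ltW.
  lra.
have n0 : 0 < `|y - x0| by apply: lt_trans ye; rewrite divr_gt0.
(* Places [t *: y + (1 - t) *: x0] at distance [e / 2] from [x0], inside the ball where
   [phi > r0 - 1]. Convexity then gives [c > r0 - t^-1], and [t^-1] is the slope [2 / e] times the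
   distance. *)
pose t := e / 2 / `|y - x0|.
have t0 : 0 < t by rewrite divr_gt0// divr_gt0.
have t1 : t <= 1 by rewrite ler_pdivrMr// mul1r ltW.
have : ((r0 - 1)%:E < (t * c + (1 - t) * r0)%:E)%E.
  apply: (@lt_le_trans _ _ (phi (t *: y + (1 - t) *: x0))); last first.
    by apply: cphi => //; [rewrite (ltW t0)|rewrite phix0].
  apply/Vphi/eV; rewrite -ball_normE /= distrC.
  have -> : t *: y + (1 - t) *: x0 - x0 = t *: (y - x0).
    by rewrite scalerBl scale1r scalerBr addrCA addrAC subrr add0r.
  rewrite normrZ (gtr0_norm t0) /t divfK ?gt_eqF//; lra.
rewrite lte_fin => tc.
have tV : 2 / e * `|y - x0| = t^-1 by rewrite /t; field; rewrite !gt_eqF.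
rewrite tV.
have : 0 < t * (c - r0 + t^-1) by rewrite mulrDr divff ?gt_eqF//; lra.
rewrite pmulr_rgt0//; lra.
Qed.
End ConvexFunctions.

(** * Strong convexity of [q] and existence of proximal points *)

Section ProximalPoint.
Context {R : realType} {H : completeNormedModType R}.
Variables (dot : {dot H for idfun}) (hdot : induces_norm dot).
Implicit Types (phi : H -> \bar R) (x y p u : H) (a b c r t M : R).
Local Open Scope ring_scope.

Lemma qB x y : q (x - y) = q x + q y - dot x y.
Proof. by rewrite !(qE hdot) !dotE (dotC dot y x); field. Qed.

Lemma q_convexE t x y z :
  q (z - (t *: x + (1 - t) *: y)) =
  t * q (z - x) + (1 - t) * q (z - y) - t * (1 - t) * q (x - y).
Proof.
rewrite !(qE hdot) !dotE (dotC dot x z) (dotC dot y z) (dotC dot y x).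
by field.
Qed.

Lemma q_continuous : continuous (q : H -> R).
Proof.
move=> x; apply: cvgM; first exact: cvg_cst.
by rewrite expr2; under eq_fun do rewrite expr2; apply: cvgM; apply: cvg_norm.
Qed.

(** Letting [t] tend to 0 turns minimality along a segment, whose quadratic remainder leaves the
    error [t * b], into a first-order condition. *)
Lemma ge0_perturbed a b : 0 <= b ->
  (forall t, 0 < t -> t <= 1 -> - (t * b) <= a) -> 0 <= a.
Proof.
move=> b0 ab; rewrite leNgt; apply/negP => a0.
have ba : 0 < b - a by lra.
have t0 : 0 < - a / (b - a) by rewrite divr_gt0//; lra.
have t1 : - a / (b - a) <= 1 by rewrite ler_pdivrMr//; lra.
have := ab _ t0 t1; rewrite leNgt => /negP; apply.
rewrite ltrNr mulrAC ltr_pdivrMr//; nra.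
Qed.

Lemma lte_dense (a : R) (s : \bar R) :
  (a%:E < s)%E -> exists b : R, a < b /\ (b%:E < s)%E.
Proof.
case: s => [s||] //; last by exists (a + 1); rewrite ltry ltrDl.
by rewrite lte_fin => as_; exists ((a + s) / 2); rewrite lte_fin !midf_lt.
Qed.

(* [q_convexE] makes minimizing sequences of [phi + c * q (x - _)] Cauchy. *)
Lemma proximal_point phi c x : Gamma0 phi -> 0 < c ->
  exists p r, phi p = r%:E /\
    forall y, ((r + c * dot (y - p) (x - p))%:E <= phi y)%E.
Proof.
move=> Gphi c0.
have [x0 [a0 [b0 [b0_ge0 phi_ge]]]] := Gamma0_minorized Gphi.
have [[phiNy [x1 x1y]] lphi /econvexP cphi] := Gphi.
pose S := [set s | exists y b, (phi y <= b%:E)%E /\ s = b + c * q (x - y)].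
have S0 : S !=set0.
  exists (fine (phi x1) + c * q (x - x1)), x1, (fine (phi x1)).
  by rewrite fineK// fin_numE phiNy lt_eqF.
have infS : has_inf S.
  (* The last term is the minimum of [c / 2 * s ^+ 2 - b0 * s] over [s], with [s] standing for the
     norm of [x - y]. *)
  split=> //; exists (a0 - b0 * `|x - x0| - b0 ^+ 2 / (2 * c)).
  move=> _ [y [b [yb ->]]].
  have := le_trans (phi_ge y) yb; rewrite lee_fin.
  have : `|y - x0| <= `|x - y| + `|x - x0|.
    by rewrite (distrC x y) ler_distD.
  have : - b0 ^+ 2 / (2 * c) <= c * q (x - y) - b0 * `|x - y|.
    rewrite /q ler_pdivrMr ?mulr_gt0//.
    have := sqr_ge0 (c * `|x - y| - b0); nra.
  rewrite mulNr; nra.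
pose m := inf S.
have mS y b : (phi y <= b%:E)%E -> m <= b + c * q (x - y).
  by move=> yb; apply: ge_inf; [case: infS|exists y, b].
have /choice[F FS] : forall n, exists z : H * R, (phi z.1 <= z.2%:E)%E /\
    z.2 + c * q (x - z.1) < m + n.+1%:R^-1.
  move=> n; have [|s [y [b [yb ->]]] sm] := @inf_adherent _ S n.+1%:R^-1 _ infS.
    by rewrite invr_gt0.
  by exists (y, b).
have Fcvg : cvg ((fun n => (F n).1) @ \oo).
  apply/cauchy_cvgP/cauchy_ballP => e e0.
  (* The midpoint of two near-minimizers bounds [c * q] of their difference by twice the sum of the
     two errors; with errors below [c * e ^+ 2 / 8] this is less than [c * e ^+ 2 / 2]. *)
  have [N NP] : exists N, forall n, (N <= n)%N -> n.+1%:R^-1 < c * e ^+ 2 / 8.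
    have : 0 < c * e ^+ 2 / 8 by rewrite divr_gt0 ?mulr_gt0 ?exprn_gt0.
    move=> e1; have [N _ NP] := near_infty_natSinv_lt (PosNum e1).
    by exists N => n /NP.
  rewrite near_map2; exists ([set n | (N <= n)%N], [set n | (N <= n)%N]).
    by split; exists N.
  move=> [n k] /= [Nn Nk]; rewrite -ball_normE /=.
  have [n1 n2] := FS n; have [k1 k2] := FS k.
  have /mS : (phi (2^-1 *: (F n).1 + (1 - 2^-1) *: (F k).1)%R <=
     (2^-1 * (F n).2 + (1 - 2^-1) * (F k).2)%:E)%E by apply: cphi => //; lra.
  rewrite q_convexE => mm.
  have {k1} := NP _ Nk; have {n1} := NP _ Nn; move: n2 k2 mm.
  set en := n.+1%:R^-1; set ek := k.+1%:R^-1; move=> n2 k2 mm en0 ek0.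
  have : c * q ((F n).1 - (F k).1) <= 2 * (en + ek) by lra.
  rewrite /q => cq.
  have : `|(F n).1 - (F k).1| ^+ 2 < e ^+ 2 by rewrite -(ltr_pM2l c0); lra.
  by rewrite ltr_pXn2r// ?nnegrE// ltW.
pose p : H := lim ((fun n => (F n).1) @ \oo).
have Fp : (fun n => (F n).1) @ \oo --> p by [].
(* Lower semicontinuity passes the bounds along the minimizing sequence to its limit, so [p] attains
   the infimum [m]. *)
have phip : (phi p <= (m - c * q (x - p))%:E)%E.
  rewrite leNgt; apply/negP => /lte_dense[a [ma ap]].
  have [V pV Va] := lphi p a ap.
  have uF : (fun n => m + n.+1%:R^-1 - c * q (x - (F n).1)) @ \oo -->
      m + 0 - c * q (x - p).
    apply: cvgB; first by apply: cvgD; [exact: cvg_cst|exact: cvg_harmonic].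
    apply: cvgM; first exact: cvg_cst.
    apply: (@cvg_comp _ _ _ _ q _ (nbhs (x - p)) _ _ (@q_continuous _)).
    by apply: cvgB => //; exact: cvg_cst.
  suff : a <= m + 0 - c * q (x - p) by rewrite addr0 leNgt ma.
  rewrite -(cvg_lim _ uF)//; apply: limr_ge.
    by apply/cvg_ex; eexists; exact: uF.
  near=> n.
  have [n1 n2] := FS n.
  have : (a%:E < (F n).2%:E)%E.
    by apply: lt_le_trans n1; apply: Va; near: n; exact: Fp.
  by rewrite lte_fin; move: n2; set en := n.+1%:R^-1 => n2 an; lra.
have [r phipr] : exists r, phi p = r%:E.
  exists (fine (phi p)); rewrite fineK// fin_numE phiNy lt_eqF//.
  exact: le_lt_trans phip (ltry _).
exists p, r; split=> // y; apply: EFin_le => b yb.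
have mp : m = r + c * q (x - p).
  apply/eqP; rewrite eq_le mS ?phipr//=.
  by move: phip; rewrite phipr lee_fin; lra.
suff : 0 <= b - r - c * dot (y - p) (x - p) by lra.
(* Compare [p] with [t *: y + (1 - t) *: p] and divide by [t]; the second-order term is
   [t * (c * q (y - p))]. *)
apply: (@ge0_perturbed _ (c * q (y - p))) => [|t t0 t1].
  by apply: mulr_ge0; [exact: ltW|rewrite /q; have := sqr_ge0 `|y - p|; lra].
have /mS : (phi (t *: y + (1 - t) *: p)%R <= (t * b + (1 - t) * r)%:E)%E.
  by apply: cphi; rewrite ?phipr// ltW.
rewrite mp q_convexE.
have -> : x - y = (x - p) - (y - p) by rewrite opprB addrA subrK.
rewrite (qB (x - p)) (dotC _ (x - p)) => H1.
rewrite -(ler_pM2l t0); nra.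
Unshelve. all: by end_near. Qed.
End ProximalPoint.

(** * Affine minorants and conjugation *)

Section Duality.
Context {R : realType} {H : completeNormedModType R}.
Variables (dot : {dot H for idfun}) (hdot : induces_norm dot).
Implicit Types (phi : H -> \bar R) (x y p u v : H) (a b c d r t M : R).
Local Open Scope ring_scope.

Lemma lee_from_below (s s' : \bar R) :
  (forall M, (M%:E < s)%E -> (M%:E <= s')%E) -> (s <= s')%E.
Proof.
move=> ss'; rewrite leNgt; apply/negP.
case: s' ss' => [r||] ss'; last 1 first.
- case: s ss' => [r||] ss' // _.
  + by have := ss' (r - 1); rewrite lte_fin gtrBl ltr01 leeNy_eq => /(_ isT).
  + by have := ss' 0; rewrite ltry leeNy_eq => /(_ isT).
- by move=> /lte_dense[M [rM /ss']]; rewrite lee_fin leNgt rM.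
- by rewrite ltNge leey.
Qed.

(* The minorant is given by the subgradient at a proximal point of [x] whose
   penalty [c] is large. *)
Lemma affine_minorant phi M x : Gamma0 phi -> (M%:E < phi x)%E ->
  exists u d, M < dot x u + d /\ forall y, ((dot y u + d)%:E <= phi y)%E.
Proof.
move=> Gphi Mx.
have [x0 [a0 [b [b0 phi_ge]]]] := Gamma0_minorized Gphi.
have [_ lphi _] := Gphi.
have [V /nbhs_ballP[e /= e0 eV] VM] := lphi x M Mx.
pose a := a0 - b * `|x - x0|.
(* Makes [k * e > M - a]. With penalty [(b + k) / e], a proximal point farther than [e] from [x]
   gains [(b + k) * |x - p|] at [x]: the part with [b] offsets the decay of [phi], the part with [k]
   lifts the bound above [M]. *)
pose k := (`|M - a| + 1) / e.
have k0 : 0 < k by rewrite divr_gt0 ?ltr_wpDl.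
have c0 : 0 < (b + k) / e by rewrite divr_gt0// ltr_wpDl.
have [p [r [phip pmin]]] := proximal_point hdot x Gphi c0.
exists (((b + k) / e) *: (x - p)), (r - dot p (((b + k) / e) *: (x - p))).
split; last first.
  by move=> y; rewrite addrCA -[dot y _ - _]/(_ + _) -dotNl -dotDl dotZr.
rewrite addrCA -dotNl -dotDl dotZr -hdot.
have [xp|xp] := ltP `|x - p| e.
  have : (M%:E < phi p)%E by apply/VM/eV; rewrite -ball_normE.
  rewrite phip lte_fin => Mr; apply: lt_le_trans Mr _.
  by rewrite lerDl mulr_ge0 ?sqr_ge0 ?ltW.
have := phi_ge p; rewrite phip lee_fin => ar.
have px : `|p - x0| <= `|x - p| + `|x - x0| by rewrite (distrC x p) ler_distD.
have Mk : M - a < k * e.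
  by rewrite /k divfK ?gt_eqF//; have := ler_norm (M - a); lra.
have e1 : (b + k) * `|x - p| <= (b + k) / e * `|x - p| ^+ 2.
  rewrite expr2 mulrA ler_wpM2r// mulrAC ler_pdivlMr// ler_wpM2l//.
  by rewrite addr_ge0// ltW.
have e2 : k * e <= k * `|x - p| by rewrite ler_wpM2l// ltW.
have e3 : b * `|p - x0| <= b * `|x - p| + b * `|x - x0|.
  by rewrite -mulrDr ler_wpM2l.
move: Mk ar e1; rewrite mulrDl /a; lra.
Qed.

Lemma dot_inj u v : (forall x, dot x u = dot x v) -> u = v.
Proof.
move=> uv; apply/eqP; rewrite -subr_eq0 -normr_eq0 -sqrf_eq0 hdot.
by rewrite dotDr dotNr uv subrr.
Qed.

(** An affine minorant [dot y u + d] of [l] leaves a linear functional [l - dot _ u] that is bounded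
    below, hence zero. *)
Lemma riesz (l : {linear H -> R^o}) : continuous l ->
  exists u, forall x, l x = dot x u.
Proof.
move=> cl.
have Gl : Gamma0 (fun x => (l x : R)%:E).
  split.
  - by split=> //; exists 0; rewrite ltry.
  - move=> x a; rewrite lte_fin => ax.
    exists [set y | a < l y]; last by move=> y; rewrite lte_fin.
    by have /cvgr_gt := cl x; apply.
  - apply/econvexP => x y a b t /andP[t0 t1]; rewrite !lee_fin linearD !linearZ.
    by move=> xa yb; rewrite lerD// ler_wpM2l// subr_ge0.
have [|u [d [_ ld]]] := @affine_minorant _ (-1) 0 Gl.
  by rewrite lte_fin linear0 ltrN10.
exists u => x; apply/eqP/negPn/negP; rewrite -subr_eq0 => lx.
(* At this multiple of [x] the difference [l - dot _ u] equals [d - 1], below its lower bound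
   [d]. *)
have := ld (((d - 1) / (l x - dot x u)) *: x).
rewrite lee_fin linearZ dotZl /= -lerBrDl -[(_ / _) *: _]/(_ / _ * _).
rewrite -mulrBr divfK//; lra.
Qed.

Lemma conjugate_ge phi x u : ((dot x u)%:E - phi x <= conjugate dot phi u)%E.
Proof. by apply: ereal_sup_ubound; exists x. Qed.

Lemma conjugate_le phi u s :
  (forall x, ((dot x u)%:E - phi x <= s)%E) -> (conjugate dot phi u <= s)%E.
Proof. by move=> us; apply: ge_ereal_sup => _ [x _ <-]. Qed.

Lemma conjugate_affine_minorant phi u d :
  (forall y, ((dot y u + d)%:E <= phi y)%E) ->
  (conjugate dot phi u <= (- d)%:E)%E.
Proof.
move=> phi_ge; apply: conjugate_le => x; have := phi_ge x.
case: (phi x) => [r||]; rewrite ?leNye ?leeNy_eq//.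
by rewrite -EFinB !lee_fin; lra.
Qed.

Lemma fenchel_young phi x u : phi x != -oo%E ->
  ((dot x u)%:E - conjugate dot phi u <= phi x)%E.
Proof.
have := conjugate_ge phi x u.
case: (phi x) => [r||] //; last by rewrite leey.
case: (conjugate dot phi u) => [s||]; rewrite ?leeNy_eq ?leNye//.
by rewrite -!EFinB !lee_fin; lra.
Qed.

(** Every real below [phi x] is exceeded at [x] by an affine minorant, and the slope of that
    minorant is a competitor in the biconjugate. *)
Lemma fenchel_moreau phi : Gamma0 phi ->
  phi =1 conjugate dot (conjugate dot phi).
Proof.
move=> Gphi x; apply/eqP; rewrite eq_le; apply/andP; split.
  apply: lee_from_below => M /(affine_minorant Gphi)[u [d [Md phi_ge]]].
  apply: le_trans (conjugate_ge _ u x).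
  have := conjugate_affine_minorant phi_ge; rewrite (dotC dot u x).
  case: (conjugate dot phi u) => [r||]; rewrite ?leye_eq ?leey//.
  by rewrite -EFinB !lee_fin; lra.
apply: conjugate_le => u; rewrite (dotC dot u x).
by apply: fenchel_young; case: Gphi => -[].
Qed.

Lemma lower_semicontinuousB phi (g : H -> R) :
  lower_semicontinuous phi -> continuous g ->
  lower_semicontinuous (fun x => phi x - (g x)%:E)%E.
Proof.
move=> lphi cg x a ax.
have [b [ab bx]] : exists b, a + g x < b /\ (b%:E < phi x)%E.
  by apply: lte_dense; rewrite EFinD -lteBrDr.
have [V Vx Vb] := lphi x b bx.
exists (V `&` [set y | g y < b - a]).
  apply: filterI => //; have /cvgr_lt := cg x; apply; lra.
move=> y [/Vb yb /= gy]; change (a%:E < phi y - (g y)%:E)%E.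
rewrite lteBrDr// -EFinD.
by apply: le_lt_trans yb; rewrite lee_fin; lra.
Qed.

Lemma dot_continuous x : continuous (dot x : H -> R).
Proof.
move=> y.
(* Polarization reduces continuity of [dot x] to that of [q]. *)
suff -> : dot x = (fun z => q x + q z - q (x - z)) :> (H -> R).
  apply: cvgB; first by apply: cvgD; [exact: cvg_cst|exact: q_continuous].
  apply: (@cvg_comp _ _ _ _ q _ (nbhs (x - y)) _ _ (@q_continuous _ _ _)).
  by apply: cvgB; [exact: cvg_cst|exact: cvg_id].
by apply/funext => z; rewrite (qB hdot); lra.
Qed.

Lemma Gamma0_conjugate_proper phi :
  Gamma0 phi -> Defs.proper (conjugate dot phi).
Proof.
move=> Gphi; have [[phiNy [z zy]] _ _] := Gphi; split=> [u|].
  have := conjugate_ge phi z u; move: (phiNy z) zy.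
  by case: (phi z) => [r||] //= _ _; case: (conjugate _ _ _).
have [|u [d [_ phi_ge]]] := @affine_minorant phi (fine (phi z) - 1) z Gphi.
  have zfin : phi z \is a fin_num by rewrite fin_numE phiNy lt_eqF.
  by rewrite -[ltRHS]fineK// lte_fin gtrBl.
by exists u; apply: le_lt_trans (conjugate_affine_minorant phi_ge) (ltry _).
Qed.

Lemma conjugate_lower_semicontinuous phi : (forall x, phi x != -oo%E) ->
  lower_semicontinuous (conjugate dot phi).
Proof.
move=> phiNy u a /ereal_sup_gt[_ [x _ <-]].
have := phiNy x; case E : (phi x) => [r||] //= _.
rewrite -EFinB lte_fin => ax.
exists [set v | a + r < dot x v].
  by have /cvgr_gt := @dot_continuous x u; apply; lra.
move=> v /= av; apply: lt_le_trans (conjugate_ge _ x v).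
by rewrite E -EFinB lte_fin; lra.
Qed.

(** Uniqueness of the resolvent point: adding the subgradient inequalities at two candidates bounds
    the squared norm of their difference by 0. *)
Lemma Prox_eq phi p x : Defs.proper phi -> subdifferential dot phi p (x - p) ->
  Prox dot phi x = p.
Proof.
have subfin v w : Defs.proper phi -> subdifferential dot phi v w ->
    exists r, phi v = r%:E.
  move=> [phiNy [z zy]] /(_ z) /le_lt_trans/(_ zy).
  by move: (phiNy v); case: (phi v) => [r||] //=; exists r.
rewrite /Prox => phiP px.
case: xgetP => [p' _ /= p'x|/(_ p)//].
have [r pr] := subfin _ _ phiP px; have [r' pr'] := subfin _ _ phiP p'x.
have := px p'; have := p'x p; rewrite pr pr' -!EFinD !lee_fin.
have -> : x - p' = (x - p) - (p' - p) by rewrite opprB addrA subrK.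
have -> : p - p' = - (p' - p) by rewrite opprB.
move=> H1 H2; apply/eqP; rewrite -subr_eq0 -normr_eq0 -sqrf_eq0.
move: (x - p) (p' - p) H1 H2 => v w; rewrite !dotE -hdot => H1 H2.
by rewrite eq_le sqr_ge0 andbT; lra.
Qed.

Lemma Prox_scale phi c p x r : 0 < c -> phi p = r%:E ->
  (forall u, ((r + dot (u - p) (c^-1 *: (x - p)))%:E <= phi u)%E) ->
  Prox dot (fun u => (c%:E * phi u)%E) x = p.
Proof.
move=> c0 phip phi_ge; apply: Prox_eq => [|u].
  split=> [u|]; last by exists p; rewrite phip ltry.
  by have := phi_ge u; case: (phi u) => [s||]; rewrite ?gt0_muley ?lte_fin.
have := phi_ge u; rewrite phip.
case: (phi u) => [s||]; rewrite ?gt0_muley ?lte_fin ?leey// -?EFinM -?EFinD.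
by rewrite !lee_fin dotZr -(ler_pM2l c0) mulrDr mulVKf ?gt_eqF// addrC.
Qed.
End Duality.

(** * Differentiable convex functions *)

Section Smoothness.
Context {R : realType} {H : completeNormedModType R}.
Variables (dot : {dot H for idfun}) (hdot : induces_norm dot).
Implicit Types (f : H -> \bar R) (F : H -> R) (P : H -> H).
Implicit Types (x y p u v : H) (a b c d r t M beta : R).
Local Open Scope ring_scope.

(** The subgradient inequalities at [x] and at [x + h] squeeze the linearization error between 0 and
    [dot h (P (x + h) - P x)], which is at most [beta * |h| ^+ 2]. *)
Lemma subgradient_differential F P beta : 0 <= beta ->
  (forall x y, F x + dot (y - x) (P x) <= F y) ->
  (forall x y, `|P x - P y| <= beta * `|x - y|) ->
  forall x, differentiable (F : H -> R^o) x /\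
    forall v, 'd (F : H -> R^o) x v = dot v (P x).
Proof.
move=> beta0 FP PL x.
have dlin : linear (fun v => dot v (P x) : R^o).
  by move=> a u v; rewrite dotDl dotZl.
pose dM := GRing.isLinear.Build _ _ _ _ _ dlin.
pose df : {linear H -> R^o} := HB.pack (fun v => dot v (P x) : R^o) dM.
have dfc : continuous df.
  have -> : df = (dot (P x) : H -> R^o) :> (H -> R^o).
    by apply/funext => v; rewrite /= dotC.
  exact: dot_continuous.
have dfx : (F : H -> R^o) \o shift x = cst (F x : R^o) + df +o_ 0 id.
  apply/eqaddoP => e e0.
  have b1 : 0 < beta + 1 by rewrite ltr_wpDl.
  have near_e : \forall h \near (0 : H), beta * `|h| <= e.
    have := @nbhs0_lt _ H _ (divr_gt0 e0 b1); apply: filterS => h.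
    by rewrite ltr_pdivlMr// => he; have := normr_ge0 h; lra.
  near=> h.
  rewrite /= -[_ h]/(F (h + x) - (F x + dot h (P x))).
  have := FP x (h + x); have := FP (h + x) x.
  have -> : x - (h + x) = - h by rewrite opprD addrCA subrr addr0.
  rewrite addrK => F1 F2.
  have := dot_le_norm hdot h (P (h + x) - P x).
  have := PL (h + x) x; rewrite addrK => Ph.
  move: F1; rewrite dotNl dotDr dotNr => F1 F3.
  have F4 : `|h| * `|P (h + x) - P x| <= `|h| * (beta * `|h|).
    by rewrite ler_wpM2l.
  have F5 : beta * `|h| <= e by near: h.
  have F6 : `|h| * (beta * `|h|) <= e * `|h|.
    by rewrite mulrC; apply: ler_wpM2r.
  rewrite ler_norml; lra.
have dE := diff_unique dfc dfx.
by split=> [|v]; [apply/diff_locallyP; rewrite dE|rewrite dE].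
Unshelve. all: by end_near. Qed.

Lemma gradient_eq f x g :
  (forall v, 'd (fine \o f : H -> R^o) x v = dot v g) -> gradient dot f x = g.
Proof.
move=> dg; rewrite /gradient; case: xgetP => [g' _ /= dg'|/(_ g)//].
by apply: (dot_inj hdot) => v; rewrite -dg' dg.
Qed.

Lemma gradientP f x : differentiable (fine \o f : H -> R^o) x ->
  forall v, 'd (fine \o f : H -> R^o) x v = dot v (gradient dot f x).
Proof.
move=> dfx; have [g gE] := riesz hdot (diff_continuous dfx).
by rewrite (gradient_eq gE).
Qed.

Lemma convex_gradient_le f x y : econvex f -> frechet_differentiable f ->
  fine (f x) + dot (y - x) (gradient dot f x) <= fine (f y).
Proof.
move=> /econvexP cf [ffin df].
have /diff_locally/eqaddoP dfx := df x.
apply/ler_addgt0Pr => e e0.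
have d1 : 0 < `|y - x| + 1 by rewrite ltr_wpDl.
have /nbhs_ballP[a /= a0 aP] := dfx _ (divr_gt0 e0 d1).
(* Small enough for [t *: (y - x)] to lie in the ball where the linearization error is at most
   [t * e]; convexity on the segment is then divided by [t]. *)
pose t := Num.min 1 (a / (2 * (`|y - x| + 1))).
have t0 : 0 < t by rewrite lt_min ltr01 divr_gt0// mulr_gt0.
have t1 : t <= 1 by rewrite ge_min lexx.
have : ball 0 a (t *: (y - x)).
  rewrite -ball_normE /ball_ /= sub0r normrN normrZ (gtr0_norm t0).
  have /le_lt_trans -> // : t * `|y - x| <= a / (2 * (`|y - x| + 1)) * `|y - x|.
    by rewrite ler_wpM2r// ge_min lexx orbT.
  by rewrite mulrAC ltr_pdivrMr ?mulr_gt0//; have := normr_ge0 (y - x); nra.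
move=> /aP.
rewrite /= -[X in `|X|]/(fine (f (t *: (y - x) + x)) -
  (fine (f x) + 'd (fine \o f : H -> R^o) x (t *: (y - x)))).
rewrite gradientP// dotZl normrZ (gtr0_norm t0) ler_norml => /andP[lb _].
have : (f (t *: y + (1 - t) *: x)%R <=
    (t * fine (f y) + (1 - t) * fine (f x))%:E)%E.
  by apply: cf; rewrite ?(ltW t0)// fineK.
rewrite -[X in (X <= _)%E]fineK// lee_fin.
have -> : t *: y + (1 - t) *: x = t *: (y - x) + x.
  by rewrite scalerBl scale1r scalerBr addrCA addrC.
move=> ub.
have ed : e / (`|y - x| + 1) * (t * `|y - x|) <= t * e.
  rewrite mulrCA ler_wpM2l ?(ltW t0)// mulrAC ler_pdivrMr//.
  by rewrite ler_wpM2l ?(ltW e0)// lerDl.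
rewrite -(ler_pM2l t0); lra.
Qed.

(* Splitting the segment [x, y] at its midpoint improves an upper bound with
   remainder [k * |y - x|^2] to one with [(k / 2 + beta / 4) * |y - x|^2]; the
   iteration converges to [beta / 2]. *)
Lemma descent_lemma F P beta : 0 <= beta ->
  (forall x y, F x + dot (y - x) (P x) <= F y) ->
  (forall x y, `|P x - P y| <= beta * `|x - y|) ->
  forall x y, F y <= F x + dot (y - x) (P x) + beta * q (y - x).
Proof.
move=> beta0 FP PL.
have dotP v x y : dot v (P y - P x) <= beta * (`|v| * `|y - x|).
  apply: le_trans (dot_le_norm hdot _ _) _.
  by rewrite mulrCA ler_wpM2l.
(* The coefficient [beta / 2 * (1 + 2^-1 ^+ n)] solves the recursion [k := k / 2 + beta / 4] started
   at [beta]. *)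
have step n : forall x y, F y <= F x + dot (y - x) (P x) +
    beta / 2 * (1 + 2^-1 ^+ n) * `|y - x| ^+ 2.
  elim: n => [|n IHn] x y.
    have := FP y x; have := dotP (y - x) x y.
    by rewrite -(opprB y x) dotDr dotNr dotNl expr0; move: `|y - x| => d; nra.
  pose m := 2^-1 *: (x + y).
  have xm : m - x = 2^-1 *: (y - x).
    rewrite /m scalerDr scalerBr addrAC addrC; congr (_ + _).
    by rewrite -[X in _ - X]scale1r -scalerBl -scaleNr; congr (_ *: _); lra.
  have my : y - m = 2^-1 *: (y - x).
    rewrite /m scalerDr scalerBr opprD addrCA addrC; congr (_ + _).
    by rewrite -[X in X - _]scale1r -scalerBl; congr (_ *: _); lra.
  have := IHn x m; have := IHn m y; have := dotP (y - x) x m.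
  rewrite xm my normrZ !dotZl dotDr dotNr exprMn ger0_norm ?invr_ge0//.
  rewrite (exprS _ n) !expr2; move: (2^-1 ^+ n) (`|y - x|) => k d; nra.
move=> x y; apply/ler_addgt0Pr => e e0.
pose c := beta / 2 * `|y - x| ^+ 2.
have c0 : 0 <= c by rewrite mulr_ge0 ?divr_ge0 ?sqr_ge0.
have c1 : 0 < e / (c + 1) by rewrite divr_gt0// ltr_wpDl.
have [n _ nP] := near_infty_natSinv_lt (PosNum c1).
have := nP n (leqnn n) => /= nc.
have : 2^-1 ^+ n <= n.+1%:R^-1 :> R.
  by rewrite exprVn lef_pV2 ?posrE ?exprn_gt0// -natrX ler_nat ltn_expl.
move=> /le_lt_trans/(_ nc); rewrite ltr_pdivlMr ?ltr_wpDl// => nc1.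
have k0 : 0 <= 2^-1 ^+ n :> R by rewrite exprn_ge0// invr_ge0.
have := step n x y.
rewrite -[beta / 2 * _ * _]mulrA (mulrC (1 + _)) mulrA -/c /q.
have -> : beta * (2^-1 * `|y - x| ^+ 2) = c by rewrite /c; lra.
move: (2^-1 ^+ n) nc1 k0 => k nc1 k0; lra.
Qed.
End Smoothness.

(** * Convexity of [beta q - f] and of [f^* - q / beta] *)

Section SmoothConvexDuality.
Context {R : realType} {H : completeNormedModType R}.
Variables (dot : {dot H for idfun}) (hdot : induces_norm dot).
Variables (f : H -> \bar R) (Gf : Gamma0 f) (beta : R) (beta0 : (0 < beta)%R).
Implicit Types (x y p u v : H) (a b c d r t M : R).
Local Open Scope ring_scope.

Let g : H -> \bar R := fun x => ((beta * q x)%:E - f x)%E.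
Let h : H -> \bar R := fun u => (conjugate dot f u - (q u / beta)%:E)%E.

Lemma lipschitz_gradient_econvex :
  frechet_differentiable f -> beta.-lipschitz (gradient dot f) -> econvex g.
Proof.
move=> df Lf; have [ffin _] := df.
have PL x y : `|gradient dot f x - gradient dot f y| <= beta * `|x - y|.
  exact: (Lf (x, y)).
have [_ _ cf] := Gf.
have desc := descent_lemma hdot (ltW beta0)
  (fun x y => convex_gradient_le hdot x y cf df) PL.
apply/econvexP => x y a b t /andP[t0 t1].
have gE v : g v = (beta * q v - fine (f v))%:E.
  by rewrite /g -{1}(fineK (ffin v)).
rewrite !gE !lee_fin => xa yb; set z := t *: x + (1 - t) *: y.
have := desc z x; have := desc z y.
(* Together the two instances of [q_convexE] show that the convexity gap of [q] at [z] is
   [t * q (x - z) + (1 - t) * q (y - z)], which matches the remainders of the descent lemma. *)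
have := q_convexE hdot t x y 0; rewrite !sub0r -/z.
have := q_convexE hdot t x y z; rewrite subrr.
have qN v : q (- v) = q v by rewrite /q normrN.
have q0 : q (0 : H) = 0 by rewrite /q normr0 expr0n mulr0.
rewrite q0 !qN -(opprB x z) -(opprB y z) !qN.
have : t * dot (x - z) (gradient dot f z) +
    (1 - t) * dot (y - z) (gradient dot f z) = 0.
  rewrite -!dotZl -dotDl !scalerBr addrACA -/z -opprD -scalerDl.
  by rewrite [X in X *: _]addrC subrK scale1r subrr dot0l.
move: (gradient _ _ _) => p e1 e2 e3 dy dx.
have ty : (1 - t) * fine (f y) <=
    (1 - t) * (fine (f z) + dot (y - z) p + beta * q (y - z)).
  by rewrite ler_wpM2l// subr_ge0.
have tx : t * fine (f x) <=
    t * (fine (f z) + dot (x - z) p + beta * q (x - z)) by rewrite ler_wpM2l.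
have ta : t * (beta * q x - fine (f x)) <= t * a by rewrite ler_wpM2l.
have tb : (1 - t) * (beta * q y - fine (f y)) <= (1 - t) * b.
  by rewrite ler_wpM2l// subr_ge0.
have := congr1 ( *%R beta) e2; have := congr1 ( *%R beta) e3.
lra.
Qed.

(** If [f x = +oo] then [g x = -oo]. A point [z] of the domain is the midpoint of [x] and its
    reflection [w], so convexity would force [g z = -oo]. *)
Lemma econvex_fin_num x : econvex g -> f x \is a fin_num.
Proof.
move=> /econvexP cg; have [[fNy [z zy]] _ _] := Gf.
rewrite fin_numE fNy /=; apply/negP => /eqP fx.
have [r fz] : exists r, f z = r%:E.
  by move: (fNy z) zy; case: (f z) => [r||] //; exists r.
pose w := 2 *: z - x.
have [b wb] : exists b, (g w <= b%:E)%E.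
  rewrite /g; move: (fNy w); case: (f w) => [s||] // _; last first.
    by exists 0; rewrite leNye.
  by exists (beta * q w - s).
pose s := beta * q z - r.
(* The bound used at [x] is tuned so that the average is [s - 1], below [g z = s]. *)
have : (g (2^-1 *: x + (1 - 2^-1) *: w)%R <=
    (2^-1 * (2 * s - b - 2) + (1 - 2^-1) * b)%:E)%E.
  by apply: cg => //; [lra|rewrite /g fx leNye].
have -> : 2^-1 *: x + (1 - 2^-1) *: w = z.
  have -> : 1 - 2^-1 = 2^-1 :> R by lra.
  by rewrite -scalerDr /w addrC subrK scalerA mulVf// scale1r.
by rewrite /g fz -EFinB lee_fin -/s; lra.
Qed.

Lemma econvex_Gamma0 : econvex g -> Gamma0 g.
Proof.
move=> cg; have ffin x := econvex_fin_num x cg.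
have gE x : g x = (beta * q x - fine (f x))%:E.
  by rewrite /g -{1}(fineK (ffin x)).
split=> //.
  by split=> [x|]; [rewrite gE|exists 0; rewrite gE ltry].
move=> x a; rewrite gE lte_fin => ax.
(* Half of the gap [g x - a] goes to [f] and half to [beta * q], so that [g < g x + e] near [x]. *)
pose e := beta * q x - fine (f x) - a.
have e0 : 0 < e by rewrite /e; lra.
have [_ lf _] := Gf.
have [|V Vx Vf] := lf x (fine (f x) - e / 2).
  by rewrite -[X in (_ < X)%E](fineK (ffin x)) lte_fin; lra.
have Wx : nbhs x [set y | beta * q y < beta * q x + e / 2].
  have : (fun y => beta * q y) @ x --> beta * q x.
    by apply: cvgM; [exact: cvg_cst|exact: q_continuous].
  by move=> /cvgr_lt; apply; lra.
have [d /= d0 dVW] : exists2 d, 0 < d & 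
    ball x d `<=` V `&` [set y | beta * q y < beta * q x + e / 2].
  by apply/nbhs_ballP; exact: filterI.
exists (ball x d); first exact: nbhsx_ballx.
move=> y xy.
(* A convex function that is upper semicontinuous at [x] is lower
   semicontinuous there, by reflection through [x]. *)
have [|/= Vy Wy] := dVW (2 *: x - y).
  move: xy; rewrite -!ball_normE /= scaler_nat mulr2n opprB opprD addrCA.
  by rewrite [x + (- x + _)]addrA subrr sub0r distrC.
have : (g (2^-1 *: y + (1 - 2^-1) *: (2 *: x - y))%R <=
    (2^-1 * (beta * q y - fine (f y)) +
     (1 - 2^-1) * (beta * q (2 *: x - y) - fine (f (2 *: x - y))))%:E)%E.
  by move/econvexP: cg; apply; rewrite ?gE//; lra.
have -> : 2^-1 *: y + (1 - 2^-1) *: (2 *: x - y) = x.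
  have -> : 1 - 2^-1 = 2^-1 :> R by lra.
  by rewrite -scalerDr addrC subrK scalerA mulVf// scale1r.
have := Vf _ Vy.
rewrite -[X in (_ < X)%E](fineK (ffin _)) !gE !lte_fin !lee_fin.
rewrite /e in Wy *; lra.
Qed.

Lemma econvex_conjugate : econvex g -> econvex h.
Proof.
move=> cg; have ffin x := econvex_fin_num x cg.
have Gg := econvex_Gamma0 cg.
apply/econvexP => u1 u2 a b t /andP[t0 t1] u1a u2b.
set u := t *: u1 + _; set s := t * a + _.
rewrite /h leeBlDr// -EFinD; apply: conjugate_le => x.
rewrite -(fineK (ffin x)) -EFinB lee_fin leNgt; apply/negP => sx.
(* [h] is the supremum of the affine functions [A] arising from the affine
   minorants of [g]. *)
have [|v [d [xv gv]]] :=
    @affine_minorant _ _ _ hdot g (s + q u / beta + beta * q x - dot x u) x Gg.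
  by rewrite /g -[X in (_ - X)%E](fineK (ffin x)) -EFinB lte_fin; lra.
pose A w := dot w v / beta + q v / beta + d.
have Ah w c : (h w <= c%:E)%E -> A w <= c.
  (* The maximizer of [dot z (w + v) - beta * q z]: testing the conjugate of [f] there gives the
     best bound that the minorant of [g] yields. *)
  pose z := beta^-1 *: (w + v).
  rewrite /h leeBlDr// -EFinD => /(le_trans (conjugate_ge dot f z w)).
  have := gv z; rewrite /g -(fineK (ffin z)) -!EFinB !lee_fin.
  have -> : beta * q z = (q w + q v + dot w v) / beta.
    rewrite !(qE hdot) /z !dotE (dotC dot v w); field; exact: lt0r_neq0.
  have -> : dot z v = (dot w v + 2 * q v) / beta.
    by rewrite (qE hdot) /z !dotE; field; exact: lt0r_neq0.
  have -> : dot z w = (2 * q w + dot w v) / beta.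
    by rewrite (qE hdot) /z !dotE (dotC dot v w); field; exact: lt0r_neq0.
  rewrite /A; lra.
have Au : A u = t * A u1 + (1 - t) * A u2.
  by rewrite /A /u !dotE; lra.
have : A u <= s.
  rewrite Au /s lerD// ler_wpM2l ?subr_ge0//; exact: Ah.
move: u {Au} sx xv => u sx xv.
suff : dot x u + dot x v - beta * q x - q u / beta <=
    dot u v / beta + q v / beta.
  by rewrite /A; lra.
(* Completing the square bounds [dot x (u + v) - beta * q x] by [q (u + v) / beta]; with the choice
   of the minorant this gives [A u > s]. *)
have : 0 <= beta * q (x - beta^-1 *: (u + v)).
  by rewrite mulr_ge0 ?(ltW beta0)// /q mulr_ge0 ?invr_ge0// sqr_ge0.
rewrite (qB hdot) dotZr dotDr.
have -> : q (beta^-1 *: (u + v)) = (q u + q v + dot u v) / beta ^+ 2.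
  rewrite !(qE hdot) !dotE (dotC dot v u); field; exact: lt0r_neq0.
have -> k l m : beta * (k + l / beta ^+ 2 - beta^-1 * m) =
    beta * k + l / beta - m.
  by field; exact: lt0r_neq0.
lra.
Qed.

Lemma econvex_conjugate_Gamma0 : econvex h -> Gamma0 h.
Proof.
move=> ch.
have [[fNy _] _ _] := Gf.
have [cNy [u uy]] := Gamma0_conjugate_proper hdot Gf.
split=> //; first split.
- by move=> v; have := cNy v; rewrite /h; case: (conjugate _ _ _).
- exists u; move: uy; rewrite /h; case: (conjugate _ _ _) => [r||] //= _.
  by rewrite -EFinD ltry.
- apply: (@lower_semicontinuousB _ _ (conjugate dot f) (fun u => q u / beta)).
    exact: conjugate_lower_semicontinuous.
  by move=> v; apply: cvgM; [exact: q_continuous|exact: cvg_cst].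
Qed.
End SmoothConvexDuality.

(** * Envelopes and proximity operators *)

Section EnvelopeRepresentation.
Context {R : realType} {H : completeNormedModType R}.
Variables (dot : {dot H for idfun}) (hdot : induces_norm dot).
Variables (f : H -> \bar R) (Gf : Gamma0 f) (beta : R) (beta0 : (0 < beta)%R).
Implicit Types (x y p u v : H) (a b c d r t M : R).
Local Open Scope ring_scope.

Let h : H -> \bar R := fun u => (conjugate dot f u - (q u / beta)%:E)%E.

Hypothesis Gh : Gamma0 h.

(* [P x] is the point where [u |-> <x | u> - f^* u] is maximal, which makes it
   the gradient of [f] at [x]. *)
Lemma dual_maximizer : exists P : H -> H, exists r : H -> R, forall x,
  [/\ h (P x) = (r x)%:E,
      forall u, ((r x + dot (u - P x) (x - beta^-1 *: P x))%:E <= h u)%E &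
      f x = (dot x (P x) - r x - q (P x) / beta)%:E].
Proof.
have ib0 : 0 < beta^-1 by rewrite invr_gt0.
suff /choice[Pr PrP] : forall x, exists pr : H * R, [/\ h pr.1 = (pr.2)%:E,
      forall u, ((pr.2 + dot (u - pr.1) (x - beta^-1 *: pr.1))%:E <= h u)%E &
      f x = (dot x pr.1 - pr.2 - q pr.1 / beta)%:E].
  by exists (fst \o Pr), (snd \o Pr).
move=> x.
have [p [r [hp hmin]]] := proximal_point hdot (beta *: x) Gh ib0.
have {}hmin u : ((r + dot (u - p) (x - beta^-1 *: p))%:E <= h u)%E.
  have := hmin u; rewrite -dotZr scalerBr scalerA mulVf ?gt_eqF//.
  by rewrite scale1r.
exists (p, r); split=> //=.
rewrite (fenchel_moreau hdot Gf); apply/eqP; rewrite eq_le; apply/andP; split.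
  apply: conjugate_le => u; have := hmin u; rewrite /h.
  case: (conjugate dot f u) => [s||]; rewrite ?leNye//.
  rewrite -!EFinB !lee_fin (dotC dot u x) => rs.
  (* The amount by which [u] falls short of [p]: the quadratic part of the conjugate of [f] restores
     the term dropped from the subgradient inequality for [h]. *)
  have : 0 <= q (u - p) / beta.
    by rewrite divr_ge0 ?(ltW beta0)// /q mulr_ge0 ?invr_ge0// sqr_ge0.
  move: rs; rewrite (qB hdot) !dotE (dotC dot u x) (dotC dot p x).
  have -> : dot p p = 2 * q p by rewrite (qE hdot); lra.
  lra.
apply: le_trans (conjugate_ge _ _ p x).
have -> : conjugate dot f p = (r + q p / beta)%:E.
  move: hp; rewrite /h; case: (conjugate dot f p) => [s||] //.
  by rewrite -EFinB => -[<-]; rewrite subrK.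
by rewrite -EFinB lee_fin (dotC dot p x); lra.
Qed.

Lemma env_dual x : f x = ((beta * q x)%:E - env beta h (beta *: x))%E.
Proof.
have [P [r /(_ x)[hp hmin ->]]] := dual_maximizer.
have qN v : q (- v) = q v by rewrite /q normrN.
have qZ v : q (beta *: v) = beta ^+ 2 * q v.
  by rewrite !(qE hdot) !dotE; lra.
suff -> : env beta h (beta *: x) =
    (r x + q (beta *: x - P x) / beta)%:E.
  rewrite -EFinB (qB hdot) qZ dotZl; congr (_%:E); field; exact: lt0r_neq0.
apply/eqP; rewrite eq_le; apply/andP; split.
  by apply: ereal_inf_lbound; exists (P x) => //; rewrite hp -EFinD.
apply/ereal_infP => _ [u _ <-]; have := hmin u.
case: (h u) => [s||]; rewrite ?leey// -?EFinD !lee_fin => rs.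
have : 0 <= q (u - P x) / beta.
  by rewrite divr_ge0 ?(ltW beta0)// /q mulr_ge0 ?invr_ge0// sqr_ge0.
move: rs; rewrite !(qB hdot) !dotE.
rewrite (dotC dot u x) (dotC dot (P x) x).
have -> : dot (P x) (P x) = 2 * q (P x) by rewrite (qE hdot); lra.
have e1 v : beta * dot x v / beta = dot x v by field; exact: lt0r_neq0.
rewrite !mulrBl !mulrDl !e1; lra.
Qed.

(** Equality case of Fenchel-Young, as [x - beta^-1 *: p] is a subgradient of [h] at [p]. *)
Lemma conjugate_at_dual_maximizer x p r : h p = r%:E ->
  (forall u, ((r + dot (u - p) (x - beta^-1 *: p))%:E <= h u)%E) ->
  conjugate dot h (x - beta^-1 *: p) = (dot (x - beta^-1 *: p) p - r)%:E.
Proof.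
move=> hp hmin; apply/eqP; rewrite eq_le; apply/andP; split; last first.
  apply: le_trans (conjugate_ge _ _ p _).
  by rewrite hp -EFinB (dotC dot p).
apply: conjugate_le => u; have := hmin u.
case: (h u) => [s||]; rewrite ?leNye// -?EFinB ?lee_fin.
by rewrite dotDl dotNl (dotC dot p); lra.
Qed.

Lemma conjugate_ge_fin p r y : h p = r%:E ->
  ((dot y p - r)%:E <= conjugate dot h y)%E.
Proof.
by move=> hp; have := conjugate_ge dot h p y; rewrite hp -EFinB (dotC dot p).
Qed.

Lemma env_primal x : f x = env beta^-1 (conjugate dot h) x.
Proof.
have [P [r /(_ x)[hp hmin ->]]] := dual_maximizer.
apply/eqP; rewrite eq_le; apply/andP; split.
  apply/ereal_infP => _ [y _ <-]; rewrite invrK.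
  apply: le_trans (leeD2r _ (conjugate_ge_fin y hp)).
  rewrite -EFinD lee_fin.
  (* This square is the excess over [f x] once the conjugate of [h] is replaced by its affine
     minorant of slope [P x]; it vanishes at [y = x - beta^-1 *: P x], where the infimum is
     attained. *)
  have : 0 <= beta * q (x - y - beta^-1 *: P x).
    by rewrite mulr_ge0 ?(ltW beta0)// /q mulr_ge0 ?invr_ge0// sqr_ge0.
  rewrite (qB hdot (x - y)) dotZr !dotDl dotNl.
  have -> : q (beta^-1 *: P x) = q (P x) / beta ^+ 2.
    by rewrite !(qE hdot) !dotE; field; exact: lt0r_neq0.
  have -> a b c : beta * (a + b / beta ^+ 2 - beta^-1 * c) =
     beta * a + b / beta - c by field; exact: lt0r_neq0.
  lra.
apply: ereal_inf_lbound; exists (x - beta^-1 *: P x) => //.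
rewrite (conjugate_at_dual_maximizer hp hmin) -EFinD; congr (_%:E).
rewrite opprB addrCA subrr addr0 !(qE hdot) !dotE; field; exact: lt0r_neq0.
Qed.

(** Monotonicity of the subdifferential of [h], applied to the subgradients [x - beta^-1 *: p] and
    [y - beta^-1 *: p']. *)
Lemma dual_maximizer_cocoercive x y p p' r r' :
  h p = r%:E -> h p' = r'%:E ->
  (forall u, ((r + dot (u - p) (x - beta^-1 *: p))%:E <= h u)%E) ->
  (forall u, ((r' + dot (u - p') (y - beta^-1 *: p'))%:E <= h u)%E) ->
  `|p - p'| ^+ 2 <= beta * dot (x - y) (p - p').
Proof.
move=> hp hp' /(_ p') + /(_ p); rewrite hp hp' !lee_fin hdot => H1 H2.
have : 0 <= beta * (dot (x - y) (p - p') - beta^-1 * dot (p - p') (p - p')).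
  rewrite mulr_ge0 ?(ltW beta0)//; move: H1 H2; rewrite !dotE.
  rewrite (dotC dot x) (dotC dot y) (dotC dot x p') (dotC dot y p').
  rewrite (dotC dot p' p); lra.
by rewrite mulrBr mulrA divff ?gt_eqF// mul1r subr_ge0.
Qed.

Lemma cocoercive_lipschitz (T : H -> H) : inv_cocoercive dot beta T ->
  forall x y, `|T x - T y| <= beta * `|x - y|.
Proof.
move=> Tc x y.
have [->|T0] := eqVneq (T x - T y) 0.
  by rewrite normr0 mulr_ge0// ltW.
have : 0 < `|T x - T y| by rewrite normr_gt0.
move=> Tp; rewrite -(ler_pM2r Tp) -expr2; apply: le_trans (Tc x y) _.
by rewrite -mulrA ler_wpM2l ?(ltW beta0)// dot_le_norm.
Qed.

Lemma dual_maximizer_gradient : exists P : H -> H, exists r : H -> R,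
  [/\ frechet_differentiable f,
      gradient dot f =1 P,
      inv_cocoercive dot beta P,
      forall x, h (P x) = (r x)%:E &
      forall x u, ((r x + dot (u - P x) (x - beta^-1 *: P x))%:E <= h u)%E].
Proof.
have [P [r PrP]] := dual_maximizer; exists P, r.
have coP : inv_cocoercive dot beta P.
  move=> x y; have [hx mx _] := PrP x; have [hy my _] := PrP y.
  exact: dual_maximizer_cocoercive hx hy mx my.
(* [P x] is a competitor in the biconjugate of [f] at every [y] and attains it at [y = x]. *)
have sub x y : fine (f x) + dot (y - x) (P x) <= fine (f y).
  have [hx _ ->] := PrP x.
  have : ((dot y (P x) - r x - q (P x) / beta)%:E <= f y)%E.
    rewrite (fenchel_moreau hdot Gf y).
    apply: le_trans (conjugate_ge _ _ (P x) y).
    have -> : conjugate dot f (P x) = (r x + q (P x) / beta)%:E.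
      move: hx; rewrite /h; case: (conjugate dot f _) => [s||] //.
      by rewrite -EFinB => -[<-]; rewrite subrK.
    by rewrite -EFinB lee_fin (dotC dot (P x) y); lra.
  by have [_ _ ->] := PrP y; rewrite lee_fin /= dotDl dotNl; lra.
have dfP := subgradient_differential hdot (ltW beta0) sub
  (cocoercive_lipschitz coP).
split=> //.
- split=> [x|x]; first by have [_ _ ->] := PrP x.
  by have [] := dfP x.
- by move=> x; apply: (gradient_eq hdot); have [] := dfP x.
- by move=> x; have [] := PrP x.
- by move=> x; have [] := PrP x.
Qed.

Lemma gradient_Prox x :
  gradient dot f x = Prox dot (fun u => (beta%:E * h u)%E) (beta *: x).
Proof.
have [P [r [_ gP _ hP hmin]]] := dual_maximizer_gradient.
rewrite gP; apply/esym/(Prox_scale hdot beta0 (hP x)) => u.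
by rewrite scalerBr scalerA mulVf ?gt_eqF// scale1r.
Qed.

(** Conjugation exchanges points and subgradients: [P x] is a subgradient of the conjugate of [h] at
    [x - beta^-1 *: P x], so that point is the proximal point of [x]. *)
Lemma gradient_Prox_conjugate x : gradient dot f x =
  beta *: (x - Prox dot (fun u => ((beta^-1)%:E * conjugate dot h u)%E) x).
Proof.
have [P [r [_ gP _ hP hmin]]] := dual_maximizer_gradient.
have ib0 : 0 < beta^-1 by rewrite invr_gt0.
have xP : x - (x - beta^-1 *: P x) = beta^-1 *: P x.
  by rewrite opprB addrCA subrr addr0.
have PE : beta *: (beta^-1 *: P x) = P x.
  by rewrite scalerA divff ?gt_eqF// scale1r.
have hs := conjugate_at_dual_maximizer (hP x) (hmin x).
rewrite gP (Prox_scale hdot ib0 hs) xP ?PE// => z.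
rewrite invrK PE; apply: le_trans (conjugate_ge_fin z (hP x)).
by rewrite lee_fin [dot (z - _) _]dotDl dotNl; lra.
Qed.
End EnvelopeRepresentation.

(** * The cycle of implications *)

Theorem theorem2p1 (R : realType) (H : completeNormedModType R)
    (dot : {dot H for idfun}) (hdot : induces_norm dot)
    (f : H -> \bar R) (hf : Gamma0 f) (beta : R) (hbeta : (0 < beta)%R) :
  let h : H -> \bar R := fun u => conjugate dot f u - (q u / beta)%:E in
  [<-> (* (i) *)
       frechet_differentiable f /\ beta.-lipschitz (gradient dot f);
       (* (ii) *)
       econvex (fun x => (beta * q x)%:E - f x);
       (* (iii) *)
       econvex (fun u => conjugate dot f u - (q u / beta)%:E);
       (* (iv) *)
       [/\ Gamma0 h,
           f =1 env beta^-1 (conjugate dot h) &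
           f =1 (fun x => (beta * q x)%:E - env beta h (beta *: x)%R)];
       (* (v) *)
       [/\ Gamma0 h,
           frechet_differentiable f,
           gradient dot f =1
             (fun x => Prox dot (fun u => beta%:E * h u) (beta *: x)%R) &
           gradient dot f =1
             (fun x => (beta *: (x -
                Prox dot (fun u => (beta^-1)%:E * conjugate dot h u)%E x))%R)];
       (* (vi) *)
       frechet_differentiable f /\ inv_cocoercive dot beta (gradient dot f)].
Proof.
move=> h; tfae.
- by move=> [df Lf]; exact: lipschitz_gradient_econvex.
- exact: econvex_conjugate.
- move=> /(econvex_conjugate_Gamma0 hdot hf) Gh; split=> // x.
  + exact: env_primal.
  + exact: env_dual.
- move=> [Gh _ _].
  have [P [r [df _ _ _ _]]] := dual_maximizer_gradient hdot hf hbeta Gh.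
  split=> // x; first exact: gradient_Prox.
  exact: gradient_Prox_conjugate.
- move=> [Gh df _ _]; split=> //.
  have [P [r [_ gP Pc _ _]]] := dual_maximizer_gradient hdot hf hbeta Gh.
  by move=> x y; rewrite !gP; exact: Pc.
- move=> [df Gc]; split=> // -[x y] _.
  exact: (cocoercive_lipschitz hdot hbeta Gc x y).
Qed.
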